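(* Let $F = J_2(f)$ with $f \in \ell_0^2(\mathbb{N})^{\circ 2}$ such that $\mathbb{E}[F^2] = 1$. Then $$\mathbb{E}[F^4] = 3 + 32\|f\|_{\ell^4(\mathbb{N})^{\otimes 2}}^4 + 48\Big( \|( f \star_1^1 f ) \mathbf{1}_{\Delta_2}\|_{\ell^2(\mathbb{N})^{\otimes 2}}^2 - \|( f \star_1^1 f ) \mathbf{1}_{\Delta_2^c}\|_{\ell^2(\mathbb{N})^{\otimes 2}}^2 \Big).$$
   Context: $(X_n)_{n\in\mathbb{N}}$ is a Rademacher sequence: i.i.d. with $P(X_n=\pm1)=\frac12$. $\Delta_2=\{(i,j)\in\mathbb{N}^2:i\ne j\}$ and $\Delta_2^c=\{(i,i):i\in\mathbb{N}\}$. $\ell_0^2(\mathbb{N})^{\circ 2}$ is the set of symmetric square-summable functions on $\mathbb{N}^2$ vanishing on $\Delta_2^c$. For $f\in\ell_0^2(\mathbb{N})^{\circ 2}$: $J_2(f)=2\sum_{1\le i<j<\infty}f(i,j)X_iX_j$, $(f\star_1^1f)(i,j)=\sum_{a\in\mathbb{N}}f(i,a)f(j,a)$, and $\|g\|_{\ell^p(\mathbb{N})^{\otimes2}}^p=\sum_{i,j\in\mathbb{N}}|g(i,j)|^p$. *)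

(* Defs.v *)
From HB Require Import structures.
From mathcomp Require Import all_boot all_order all_algebra.
From mathcomp Require Import all_classical all_reals all_analysis.

Set Implicit Arguments.
Unset Strict Implicit.
Unset Printing Implicit Defensive.

Import Order.TTheory GRing.Theory Num.Theory.
Import numFieldNormedType.Exports.

Local Open Scope classical_set_scope.
Local Open Scope ring_scope.

Definition mutually_independent (d : measure_display) (T : measurableType d)
    (R : realType) (P : probability T R) (X : nat -> {RV P >-> R}) : Prop :=
  forall (s : seq nat) (B : nat -> set R), uniq s ->
    (forall i, measurable (B i)) ->
    P (\big[setI/setT]_(i <- s) (X i @^-1` B i)) =
    (\prod_(i <- s) P (X i @^-1` B i))%E.

Definition rademacher_sequence (d : measure_display) (T : measurableType d)
    (R : realType) (P : probability T R) (X : nat -> {RV P >-> R}) : Prop :=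
  mutually_independent X /\
  forall n, P [set w | X n w = 1] = (2^-1)%:E /\
            P [set w | X n w = -1] = (2^-1)%:E.

Definition Delta2 : set (nat * nat) := [set ij | ij.1 <> ij.2].

(* The p-th power of the l^p norm on N^2, possibly infinite. *)
Definition lpnormX (R : realType) (p : nat) (g : nat * nat -> R) : \bar R :=
  (\esum_(ij in [set: nat * nat]) (`|g ij| ^+ p)%:E)%E.

Definition in_l20_sym2 (R : realType) (f : nat * nat -> R) : Prop :=
  [/\ forall i j, f (i, j) = f (j, i),
      forall ij, (~` Delta2) ij -> f ij = 0 &
      (lpnormX 2 f < +oo)%E].

(* The limit exists for square-summable f, by the Cauchy-Schwarz inequality. *)
Definition star11 (R : realType) (f : nat * nat -> R) : nat * nat -> R :=
  fun ij => limn (series (fun a => f (ij.1, a) * f (ij.2, a))).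

Definition J2_partial (d : measure_display) (T : measurableType d)
    (R : realType) (P : probability T R) (X : nat -> {RV P >-> R})
    (f : nat * nat -> R) (n : nat) : T -> R :=
  fun w => 2 * \sum_(j < n) \sum_(i < j) f (i : nat, j : nat) * X i w * X j w.

(* F is a version of J_2(f), whose defining double series is understood in
   L^2(P).  For f square-summable the series converges unconditionally, so
   summing over the squares i < j < n loses nothing. *)
Definition is_J2 (d : measure_display) (T : measurableType d)
    (R : realType) (P : probability T R) (X : nat -> {RV P >-> R})
    (f : nat * nat -> R) (F : {RV P >-> R}) : Prop :=
  Lnorm P 2%:E (fun w => (J2_partial X f n w - F w)%:E) @[n --> \oo] --> 0%E.

(* Main.v *)
Require Import Defs.
From HB Require Import structures.
From mathcomp Require Import all_boot all_order all_algebra.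
From mathcomp Require Import all_classical all_reals all_analysis.
From mathcomp Require Import measurable_realfun ring lra.

(** Let F_n = 2 sum_(i < j < n) f(i,j) X_i X_j, so that
    F_(n+1) = F_n + 2 X_n L_n with L_n = sum_(i < n) f(i,n) X_i.  Averaging over
    the sign X_n kills the odd powers of X_n, so the mixed moments of quadratic
    and linear forms in n signs obey recursions in n, which the closed formulas
    for E[L^2 M^2], E[F_n^2 L^2] and finally E[F_n^4] satisfy.

    To pass from F_n to its L^2 limit F no hypercontractivity is needed:
    E[F^4] <= lim E[F_n^4] follows by truncating F, and E[F_m^4] <= E[F^4] from
    z^4 >= y^4 + 4 y^3 (z - y) with y = F_m, since E[F_m^3 (F_k - F_m)] = 0 for
    k >= m.  The finite sums in the formula converge because
    (sum_(a < n) f(i,a) f(k,a))^2 <= r_i r_k, where r_i = sum_a f(i,a)^2. *)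

Set Implicit Arguments.
Unset Strict Implicit.
Unset Printing Implicit Defensive.

Import Order.TTheory GRing.Theory Num.Theory.
Import numFieldNormedType.Exports.

Local Open Scope classical_set_scope.
Local Open Scope ring_scope.

(** * Moments of linear and quadratic forms in finitely many signs *)

Section SignAverage.
Context {R : realFieldType}.
Implicit Types (b : nat -> bool) (g h : (nat -> bool) -> R).

Definition upd b n s : nat -> bool := fun i => if i == n then s else b i.

(** The signs of index at least [n] are frozen to [false], i.e. to -1. *)
Fixpoint signmean n g : R :=
  if n is n'.+1 then
    signmean n' (fun b => (g (upd b n' true) + g (upd b n' false)) / 2)
  else g (fun=> false).

Lemma eq_signmean n g h : g =1 h -> signmean n g = signmean n h.
Proof.
elim: n g h => [|n IH] g h gh /=; first exact: gh.
by apply: IH => b; rewrite !gh.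
Qed.

Lemma signmeanD n g h : signmean n (fun b => g b + h b) = signmean n g + signmean n h.
Proof.
elim: n g h => [|n IH] g h //=; rewrite -IH; apply: eq_signmean => b; ring.
Qed.

Lemma signmeanZ n c g : signmean n (fun b => c * g b) = c * signmean n g.
Proof.
elim: n g => [|n IH] g //=; rewrite -IH; apply: eq_signmean => b; ring.
Qed.

Lemma signmean_cst n c : signmean n (fun=> c) = c.
Proof. by elim: n => [|n IH] //=; rewrite -[RHS]IH; apply: eq_signmean => b; field. Qed.

(** Most recursions below run through this step: only the last sign is averaged explicitly, and what
    remains is again a mean over the earlier signs. *)
Lemma signmeanS n g h :
  (forall b, (g (upd b n true) + g (upd b n false)) / 2 = h b) ->
  signmean n.+1 g = signmean n h.
Proof. by move=> gh /=; apply: eq_signmean. Qed.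

Definition sg (s : bool) : R := if s then 1 else -1.

Definition linform n (a : nat -> R) b := \sum_(i < n) a i * sg (b i).

(** Grouped by the larger index, so that each new sign multiplies a single linear form. Only entries
    above the diagonal are read, hence the factor 2. *)
Definition quadform n (A : nat -> nat -> R) b :=
  \sum_(j < n) 2 * linform j (A^~ j) b * sg (b j).

Lemma linform_upd n m a b s : (n <= m)%N ->
  linform n a (upd b m s) = linform n a b.
Proof.
move=> nm; apply: eq_bigr => i _; rewrite /upd ltn_eqF//.
exact: leq_trans (ltn_ord i) nm.
Qed.

Lemma quadform_upd n m A b s : (n <= m)%N ->
  quadform n A (upd b m s) = quadform n A b.
Proof.
move=> nm; apply: eq_bigr => i _.
have im : (i < m)%N by exact: leq_trans (ltn_ord i) nm.
by rewrite linform_upd ?(ltnW im)// /upd ltn_eqF.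
Qed.

Lemma linformS n a b s :
  linform n.+1 a (upd b n s) = linform n a b + a n * sg s.
Proof. by rewrite /linform big_ord_recr/= -/(linform n a _) linform_upd// /upd eqxx. Qed.

Lemma quadformS n A b s :
  quadform n.+1 A (upd b n s) =
  quadform n A b + 2 * linform n (A^~ n) b * sg s.
Proof.
rewrite /quadform big_ord_recr/= -/(quadform n A _) quadform_upd//.
by rewrite linform_upd// /upd eqxx.
Qed.

Lemma signmean_linform2 n a c :
  signmean n (fun b => linform n a b * linform n c b) = \sum_(i < n) a i * c i.
Proof.
elim: n => [|n IH]; first by rewrite big_ord0/= /linform !big_ord0 mul0r.
rewrite big_ord_recr/= -IH -[X in _ + X](signmean_cst n) -signmeanD.
by apply: eq_signmean => b; rewrite !linformS /=; field.
Qed.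

Lemma sum_mulxx n (u : nat -> R) :
  \sum_(i < n) u i * u i = \sum_(i < n) u i ^+ 2.
Proof. by under eq_bigr do rewrite -expr2. Qed.

(** The first two terms are what Wick's formula gives for Gaussian variables; the last one comes
    from the fourth cumulant of a sign, which is -2. *)
Lemma signmean_linform4 n a c :
  signmean n (fun b => linform n a b ^+ 2 * linform n c b ^+ 2) =
  (\sum_(i < n) a i ^+ 2) * (\sum_(i < n) c i ^+ 2)
  + 2 * (\sum_(i < n) a i * c i) ^+ 2 - 2 * \sum_(i < n) a i ^+ 2 * c i ^+ 2.
Proof.
elim: n => [|n IH]; first by rewrite !big_ord0/= /linform !big_ord0; ring.
rewrite (@signmeanS _ _ (fun b => linform n a b ^+ 2 * linform n c b ^+ 2
  + (c n ^+ 2 * (linform n a b * linform n a b)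
  + (a n ^+ 2 * (linform n c b * linform n c b)
  + (4 * a n * c n * (linform n a b * linform n c b)
  + a n ^+ 2 * c n ^+ 2))))); last first.
  by move=> b; rewrite !linformS /=; field.
rewrite !(signmeanD, signmeanZ, signmean_cst) IH !signmean_linform2 !sum_mulxx !big_ord_recr/=.
by ring.
Qed.

Lemma signmean_quadform n A : signmean n (fun b => quadform n A b) = 0.
Proof.
elim: n => [|n <-]; first by rewrite /= /quadform big_ord0.
by apply: signmeanS => b; rewrite !quadformS /=; field.
Qed.

(** A martingale argument: each increment beyond [m] is odd in a sign that [quadform m] does not
    read, so it averages to zero against the cube. *)
Lemma signmean_quadform_cube m k A : (m <= k)%N ->
  signmean k (fun b => quadform m A b ^+ 3 * quadform k A b) =
  signmean k (fun b => quadform m A b ^+ 4).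
Proof.
elim: k => [|k IH].
  by rewrite leqn0 => /eqP ->; apply: eq_signmean => b; rewrite -exprSr.
rewrite leq_eqVlt => /predU1P[->|]; first by apply: eq_signmean => b; rewrite -exprSr.
rewrite ltnS => mk.
transitivity (signmean k (fun b => quadform m A b ^+ 3 * quadform k A b)).
  by apply: signmeanS => b; rewrite !quadformS !quadform_upd//=; field.
by rewrite IH//; apply/esym/signmeanS => b; rewrite !quadform_upd//=; field.
Qed.

Lemma signmean_quadform_stable m k A p : (m <= k)%N ->
  signmean k (fun b => quadform m A b ^+ p) = signmean m (fun b => quadform m A b ^+ p).
Proof.
elim: k => [|k IH]; first by rewrite leqn0 => /eqP ->.
rewrite leq_eqVlt => /predU1P[->//|]; rewrite ltnS => mk.
by rewrite -IH//; apply: signmeanS => b; rewrite !quadform_upd//; field.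
Qed.

(** * Moments of quadratic forms of a symmetric matrix with zero diagonal *)

Section Moments.
Variable A : nat -> nat -> R.
Hypothesis Asym : forall i j, A i j = A j i.
Hypothesis Adiag : forall i, A i i = 0.

Lemma sum_sym_offdiagS (S : nat -> nat -> R) n : (forall i j, S i j = S j i) ->
  \sum_(i < n.+1) \sum_(j < n.+1) S i j =
  \sum_(i < n) \sum_(j < n) S i j + 2 * (\sum_(i < n) S i n) + S n n.
Proof.
move=> Ssym; rewrite big_ord_recr/=.
have -> : \sum_(i < n) \sum_(j < n.+1) S i j =
  \sum_(i < n) \sum_(j < n) S i j + \sum_(i < n) S i n.
  by rewrite -big_split; apply: eq_bigr => i _; rewrite big_ord_recr.
rewrite big_ord_recr/=.
by under [X in _ + (X + _)]eq_bigr do rewrite Ssym; ring.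
Qed.

Lemma sum_sqr_mxS n : \sum_(i < n.+1) \sum_(j < n.+1) A i j ^+ 2 =
  \sum_(i < n) \sum_(j < n) A i j ^+ 2 + 2 * \sum_(i < n) A i n ^+ 2.
Proof.
rewrite (sum_sym_offdiagS (S := fun i j => A i j ^+ 2)) => [|i j]; last by rewrite Asym.
by rewrite Adiag; ring.
Qed.

Lemma signmean_quadform_sqr n : signmean n (fun b => quadform n A b ^+ 2) =
  2 * \sum_(i < n) \sum_(j < n) A i j ^+ 2.
Proof.
elim: n => [|n IH].
  by rewrite /= /quadform !big_ord0 ?mulr0 expr0n.
rewrite (@signmeanS _ _ (fun b => quadform n A b ^+ 2
    + 4 * (linform n (A^~ n) b * linform n (A^~ n) b))); last first.
  by move=> b; rewrite !quadformS /=; field.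
rewrite signmeanD signmeanZ IH signmean_linform2 (sum_mulxx n (A^~ n)) sum_sqr_mxS.
by ring.
Qed.

(** Only the terms in which the two signs of the quadratic form match those of the two linear forms
    survive, which leaves 2 a^T A c. This is the cross term in the recursion for
    [quadform ^+ 2 * linform ^+ 2]. *)
Lemma signmean_quadform_linform2 n a c :
  signmean n (fun b => quadform n A b * (linform n a b * linform n c b)) =
  2 * \sum_(i < n) a i * \sum_(j < n) A i j * c j.
Proof.
elim: n => [|n IH].
  by rewrite /= /quadform !big_ord0 ?mulr0 mul0r.
rewrite (@signmeanS _ _ (fun b => quadform n A b * (linform n a b * linform n c b)
    + (a n * c n * quadform n A b
    + (2 * c n * (linform n a b * linform n (A^~ n) b)
    + 2 * a n * (linform n (A^~ n) b * linform n c b))))); last first.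
  by move=> b; rewrite !quadformS !linformS /=; field.
rewrite !(signmeanD, signmeanZ) IH !signmean_linform2 signmean_quadform big_ord_recr/=.
have -> : \sum_(i < n) a i * (\sum_(j < n.+1) A i j * c j) =
  \sum_(i < n) a i * (\sum_(j < n) A i j * c j) + c n * \sum_(i < n) a i * A i n.
  rewrite mulr_sumr -big_split; apply: eq_bigr => i _.
  by rewrite big_ord_recr/=; ring.
rewrite big_ord_recr/= Adiag.
under [X in _ + a n * (X + _)]eq_bigr do rewrite Asym.
by ring.
Qed.

(** For symmetric [A], the entries of the square of the truncated matrix; the finite counterpart of
    [star11]. *)
Definition sqmx n i k := \sum_(a < n) A i a * A k a.

Lemma sqmxC n i k : sqmx n i k = sqmx n k i.
Proof. by apply: eq_bigr => a _; rewrite mulrC. Qed.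

Lemma sqmxS n i k : sqmx n.+1 i k = sqmx n i k + A i n * A k n.
Proof. exact: big_ord_recr. Qed.

(** The identity u^T A^2 u = |A u|^2 for a symmetric matrix. *)
Lemma sum_mul_sqmx n (u : nat -> R) :
  \sum_(i < n) \sum_(k < n) sqmx n i k * (u i * u k) =
  \sum_(i < n) (\sum_(j < n) A i j * u j) ^+ 2.
Proof.
under eq_bigr => i _ do under eq_bigr => k _ do rewrite mulr_suml.
under eq_bigr => i _ do rewrite exchange_big/=.
rewrite exchange_big/=; apply: eq_bigr => a _.
rewrite expr2 mulr_suml; apply: eq_bigr => i _.
by rewrite mulr_sumr; apply: eq_bigr => k _; rewrite !(Asym a); ring.
Qed.

(** The first term is the product of the two second moments. The second is the covariance of the two
    squares: 8 times the off-diagonal part of a^T A^2 a. *)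
Lemma signmean_quadform2_linform2 n a :
  signmean n (fun b => quadform n A b ^+ 2 * linform n a b ^+ 2) =
  2 * (\sum_(i < n) a i ^+ 2) * (\sum_(i < n) \sum_(j < n) A i j ^+ 2)
  + 8 * ((\sum_(i < n) (\sum_(j < n) A i j * a j) ^+ 2)
         - \sum_(i < n) sqmx n i i * a i ^+ 2).
Proof.
elim: n => [|n IH].
  by rewrite /= /quadform !big_ord0 ?mulr0 /=; ring.
rewrite (@signmeanS _ _ (fun b => quadform n A b ^+ 2 * linform n a b ^+ 2
    + (a n ^+ 2 * quadform n A b ^+ 2
    + (4 * (linform n (A^~ n) b ^+ 2 * linform n a b ^+ 2)
    + (4 * a n ^+ 2 * (linform n (A^~ n) b * linform n (A^~ n) b)
    + 8 * a n * (quadform n A b * (linform n (A^~ n) b * linform n a b)))))));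
  last first.
  by move=> b; rewrite !quadformS !linformS /=; field.
rewrite !(signmeanD, signmeanZ) IH signmean_linform4 signmean_linform2 signmean_quadform_sqr.
rewrite signmean_quadform_linform2 (sum_mulxx n (A^~ n)) sum_sqr_mxS.
rewrite !(big_ord_recr n (idx := 0))/= !Adiag.
have -> : \sum_(i < n) (\sum_(j < n.+1) A i j * a j) ^+ 2 =
  \sum_(i < n) (\sum_(j < n) A i j * a j) ^+ 2
  + 2 * a n * (\sum_(i < n) A i n * (\sum_(j < n) A i j * a j))
  + a n ^+ 2 * \sum_(i < n) A i n ^+ 2.
  rewrite !mulr_sumr -!big_split; apply: eq_bigr => i _.
  by rewrite big_ord_recr/=; ring.
have -> : \sum_(i < n) sqmx n.+1 i i * a i ^+ 2 =
  \sum_(i < n) sqmx n i i * a i ^+ 2 + \sum_(i < n) A i n ^+ 2 * a i ^+ 2.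
  by rewrite -big_split; apply: eq_bigr => i _; rewrite sqmxS/=; ring.
have -> : \sum_(i < n) A n i * a i = \sum_(i < n) A i n * a i.
  by apply: eq_bigr => i _; rewrite Asym.
have -> : sqmx n.+1 n n = \sum_(i < n) A i n ^+ 2.
  rewrite sqmxS Adiag mul0r addr0; apply: eq_bigr => i _.
  by rewrite !(Asym n) expr2.
by ring.
Qed.

(** The finite form of the theorem; the first term is three times the squared second moment. With Q
    the old form and L the linear form of the new column, averaging (Q + 2 L s)^4 over the sign s
    gives Q^4 + 24 Q^2 L^2 + 16 L^4. *)
Lemma signmean_quadform4 n : signmean n (fun b => quadform n A b ^+ 4) =
  12 * (\sum_(i < n) \sum_(j < n) A i j ^+ 2) ^+ 2
  + 32 * (\sum_(i < n) \sum_(j < n) A i j ^+ 4)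
  + 48 * ((\sum_(i < n) \sum_(k < n) sqmx n i k ^+ 2)
          - 2 * \sum_(i < n) sqmx n i i ^+ 2).
Proof.
elim: n => [|n IH].
  by rewrite /= /quadform !big_ord0 ?mulr0 /=; ring.
rewrite (@signmeanS _ _ (fun b => quadform n A b ^+ 4
    + (24 * (quadform n A b ^+ 2 * linform n (A^~ n) b ^+ 2)
    + 16 * (linform n (A^~ n) b ^+ 2 * linform n (A^~ n) b ^+ 2)))); last first.
  by move=> b; rewrite !quadformS /=; field.
rewrite !(signmeanD, signmeanZ) IH signmean_linform4 signmean_quadform2_linform2.
rewrite (sum_mulxx n (A^~ n)) sum_sqr_mxS.
rewrite (sum_sym_offdiagS (S := fun i j => A i j ^+ 4)) => [|i j]; last by rewrite Asym.
rewrite (sum_sym_offdiagS (S := fun i j => sqmx n.+1 i j ^+ 2)) => [|i j]; last by rewrite sqmxC.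
rewrite Adiag big_ord_recr/=.
have -> : sqmx n.+1 n n = \sum_(i < n) A i n ^+ 2.
  rewrite sqmxS Adiag mul0r addr0; apply: eq_bigr => i _.
  by rewrite !(Asym n) expr2.
have -> : \sum_(i < n) sqmx n.+1 i n ^+ 2 =
  \sum_(i < n) (\sum_(j < n) A i j * A j n) ^+ 2.
  apply: eq_bigr => i _; rewrite sqmxS Adiag mulr0 addr0; congr (_ ^+ 2).
  by apply: eq_bigr => j _; rewrite (Asym n).
have -> : \sum_(i < n) sqmx n.+1 i i ^+ 2 = \sum_(i < n) sqmx n i i ^+ 2
    + 2 * (\sum_(i < n) sqmx n i i * A i n ^+ 2) + \sum_(i < n) A i n ^+ 4.
  rewrite mulr_sumr -!big_split; apply: eq_bigr => i _.
  by rewrite sqmxS/=; ring.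
have -> : \sum_(i < n) \sum_(k < n) sqmx n.+1 i k ^+ 2 =
    \sum_(i < n) \sum_(k < n) sqmx n i k ^+ 2
    + 2 * (\sum_(i < n) \sum_(k < n) sqmx n i k * (A i n * A k n))
    + (\sum_(i < n) A i n ^+ 2) * (\sum_(k < n) A k n ^+ 2).
  rewrite mulr_suml mulr_sumr -!big_split; apply: eq_bigr => i _.
  rewrite mulr_sumr /= mulr_sumr -!big_split; apply: eq_bigr => k _.
  by rewrite sqmxS/=; ring.
(* With u the new column, the change of the old entries of the square and its new row and column
   each contribute 2 |A u|^2; the total 48 * 4 matches the 24 * 8 of the recursion. *)
rewrite (sum_mul_sqmx n (A^~ n)).
have -> : \sum_(i < n) A i n ^+ 2 * A i n ^+ 2 = \sum_(i < n) A i n ^+ 4.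
  by apply: eq_bigr => i _; rewrite -exprD.
by ring.
Qed.

End Moments.
End SignAverage.

(** * Rademacher sequences as random signs *)

Section Signs.
Context {R : realType} {d : measure_display} {T : measurableType d}.
Context {P : probability T R} (X : nat -> {RV P >-> R}).

(** [X n] equals 1 or -1 only almost surely; the event [X n = 1] and its
    complement give genuine bits, hence simple functions. *)
Definition signs n (w : T) : nat -> bool := fun i => (i < n)%N && (X i w == 1).

Definition sign_val (s : bool) : set R := if s then [set 1] else ~` [set 1].

Definition sign_event (s : seq nat) (v : nat -> bool) : set T :=
  \big[setI/setT]_(i <- s) (X i @^-1` sign_val (v i)).

Lemma measurable_sign_val s : measurable (sign_val s).
Proof. by case: s => /=; [|apply: measurableC]; exact: measurable_set1. Qed.

Lemma measurable_sign_event s v : measurable (sign_event s v).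
Proof.
apply: bigsetI_measurable => i _.
by apply: measurable_funPTI; exact: measurable_sign_val.
Qed.

Lemma sign_event_upd s v n b : n \notin s ->
  sign_event s (upd v n b) = sign_event s v.
Proof.
move=> ns; rewrite /sign_event !big_seq; apply: eq_bigr => i si.
by rewrite /upd; case: eqP => // ?; subst i; rewrite si in ns.
Qed.

Lemma sign_event_cons s v n b : n \notin s ->
  sign_event (n :: s) (upd v n b) = X n @^-1` sign_val b `&` sign_event s v.
Proof.
by move=> ns; rewrite -(sign_event_upd v b ns) /sign_event big_cons {1}/upd eqxx.
Qed.

Lemma signs0 w : signs 0 w = fun=> false.
Proof. by apply/funext => i; rewrite /signs ltn0. Qed.

Lemma signsS n w : signs n.+1 w = upd (signs n w) n (X n w == 1).
Proof.
apply/funext => i; rewrite /signs /upd ltnS leq_eqVlt.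
by case: eqP => [->|_].
Qed.

Hypothesis hX : rademacher_sequence X.

Lemma sign_event_prob s v : uniq s -> P (sign_event s v) = (2^-1 ^+ size s)%:E.
Proof.
case: hX => indep half us.
rewrite (indep _ (fun i => sign_val (v i)) us); last by move=> i; exact: measurable_sign_val.
elim: s {us} => [|i s IH]; first by rewrite big_nil expr0.
rewrite big_cons IH exprS EFinM; congr (_ * _)%E.
have h1 := (half i).1.
have m1 : measurable (X i @^-1` [set 1]) by exact: measurable_funPTI.
case: (v i) => //=.
rewrite -preimage_setC probability_setC//.
have -> : P (X i @^-1` [set 1]) = (2^-1)%:E by exact: h1.
by rewrite -EFinB; congr (_%:E); field.
Qed.

(** Here [g] is arbitrary: only finitely many bits vary, and the induction branches on one of them
    at a time. *)
Lemma measurable_signs (g : (nat -> bool) -> R) n :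
  measurable_fun setT (fun w => g (signs n w)).
Proof.
elim: n g => [|n IH] g.
  by under eq_fun do rewrite signs0; exact: measurable_cst.
rewrite (_ : (fun _ => _) = fun w => if X n w == 1 then g (upd (signs n w) n true)
    else g (upd (signs n w) n false)).
  apply: measurable_fun_ifT; last 2 first.
  - exact: (IH (fun b => g (upd b n true))).
  - exact: (IH (fun b => g (upd b n false))).
  apply: measurable_fun_eqr => //.
by apply/funext => w; rewrite signsS; case: ifP.
Qed.

(** Strengthened for induction by fixing the signs with indices in [s], all at least [n]. The event
    is split by the last sign, whose index then joins [s]; independence enters at [n = 0], where the
    integrand is constant. *)
Lemma integral_sign_event (g : (nat -> bool) -> R) n s v :
  (forall b, 0 <= g b) -> uniq s -> all (leq n) s ->
  (\int[P]_(w in sign_event s v) (g (signs n w))%:E =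
   (signmean n g * 2^-1 ^+ size s)%R%:E)%E.
Proof.
elim: n g s v => [|n IH] g s v g0 us ns.
  under eq_integral do rewrite signs0.
  rewrite integral_cst; last exact: measurable_sign_event.
  transitivity ((g (fun=> false))%:E * P (sign_event s v))%E; first by [].
  by rewrite sign_event_prob.
have nins : n \notin s.
  by apply/negP => /(allP ns); rewrite ltnn.
have split_event : sign_event s v =
  sign_event (n :: s) (upd v n true) `|` sign_event (n :: s) (upd v n false).
  by rewrite !sign_event_cons// -setIUl /= -preimage_setC setUCr setTI.
have uns : uniq (n :: s) by rewrite /= nins.
have nns : all (leq n) (n :: s).
  by rewrite /= leqnn; apply: sub_all ns => i /ltnW.
rewrite {1}split_event ge0_integral_setU//=; last 5 first.
- exact: measurable_sign_event.
- exact: measurable_sign_event.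
- by apply/measurable_EFinP; apply: measurable_funTS; exact: measurable_signs.
- by move=> w _; rewrite lee_fin.
- apply/disj_setPS => w; rewrite !sign_event_cons//= => -[[Xn1 _] [Xn1' _]].
  exact: Xn1'.
have half b : (\int[P]_(w in sign_event (n :: s) (upd v n b)) (g (signs n.+1 w))%:E =
   (signmean n (fun y => g (upd y n b)) * 2^-1 ^+ (size s).+1)%R%:E)%E.
  rewrite -(IH _ (n :: s) (upd v n b))//; apply: eq_integral => w.
  rewrite inE sign_event_cons// => -[Xw _]; rewrite signsS.
  congr ((g (upd _ _ _))%:E).
  by case: b Xw => /= [->|/eqP/negbTE//]; rewrite eqxx.
rewrite !half -EFinD; congr (_%:E); rewrite -mulrDl -signmeanD exprS mulrA.
by congr (_ * _); rewrite mulrC -signmeanZ; apply: eq_signmean => b; rewrite mulrC.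
Qed.

Lemma integral_signs (g : (nat -> bool) -> R) n : (forall b, 0 <= g b) ->
  (\int[P]_w (g (signs n w))%:E = (signmean n g)%:E)%E.
Proof.
move=> g0; have := @integral_sign_event g n [::] xpredT g0 isT isT.
by rewrite /sign_event big_nil mulr1.
Qed.

(** The values 1 and -1 carry mass 1/2 + 1/2 = 1, so all other values form a null event. *)
Lemma ae_signs n : {ae P, forall w, X n w = sg (X n w == 1)}.
Proof.
have m c : measurable (X n @^-1` [set c]) by exact: measurable_funPTI.
exists (~` (X n @^-1` [set 1] `|` X n @^-1` [set -1])); split.
- by apply: measurableC; apply: measurableU.
- rewrite probability_setC; last by apply: measurableU.
  rewrite measureU//; last first.
    apply/seteqP; split=> w //= -[->] h; have : (1 : R) <> -1 by lra.
    by [].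
  case: hX => _ /(_ n) [h1 h2].
  transitivity (1 - (P [set w | X n w = 1%R] + P [set w | X n w = (-1)%R]))%E; first by [].
  rewrite h1 h2 -EFinD (_ : 2^-1 + 2^-1 = 1 :> R); last by field.
  by rewrite subrr.
move=> w /=; apply: contra_not => -[] -> /=; rewrite ?eqxx//.
by case: eqP => //= h; exfalso; lra.
Qed.

(** Outside a countable union of null sets every [X i] is a sign. Hence the moments of the partial
    sums are values of [signmean]. *)
Lemma ae_J2_partial f n :
  {ae P, forall w, J2_partial X f n w = quadform n (curry f) (signs n w)}.
Proof.
have : {ae P, forall w, forall i, X i w = sg (X i w == 1)}.
  by apply/ae_foralln => i; exact: ae_signs.
apply: filterS => w sgX.
rewrite /J2_partial /quadform mulr_sumr; apply: eq_bigr => j _.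
rewrite -mulr_suml mulrA /linform; congr (_ * _ * _).
  apply: eq_bigr => i _; rewrite {1}sgX/=.
  by rewrite /signs (ltn_trans _ (ltn_ord j)).
by rewrite {1}sgX /signs ltn_ord.
Qed.

End Signs.

(** * Fourth moments of L^2 limits *)

Section RealInequalities.
Context {R : realType}.
Implicit Types x y z t K : R.

(** The estimates below hold for each fixed weight t > 0, with constants that may blow up as t
    vanishes; the index tends to infinity first, and this then lets t tend to 0. *)
Lemma lee_at_right0 (u : R -> R) (l : R) (a : \bar R) : u 0 = l ->
  {for 0, continuous u} -> (forall t, 0 < t -> (a <= (u t)%:E)%E) -> (a <= l%:E)%E.
Proof.
move=> <- cu au; apply: (@cvge_ge _ (0^'+) _ _ (fun t => (u t)%:E)).
  by near=> t; apply: au; near: t; exact: nbhs_right_gt.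
by apply: cvg_EFin; [near=> t|apply: cvg_at_right_filter; exact: cu].
Unshelve. all: by end_near. Qed.

(** Young's inequality, the defect being [t * (x - y / t) ^+ 2]. The main term [x] keeps a factor
    close to 1, at the price of a large one on [y]. *)
Lemma sqrD_weighted x y t : 0 < t ->
  (x + y) ^+ 2 <= (1 + t) * x ^+ 2 + (1 + t^-1) * y ^+ 2.
Proof.
move=> t0; rewrite -subr_ge0.
have -> : (1 + t) * x ^+ 2 + (1 + t^-1) * y ^+ 2 - (x + y) ^+ 2 =
  t * (x - y / t) ^+ 2 by field; rewrite gt_eqF.
by rewrite mulr_ge0 ?sqr_ge0// ltW.
Qed.

(** If |x| <= (1 + t) |y|, the first term suffices. Otherwise |x| <= (1 + 1/t) |x - y|; two of the
    four factors are bounded by this and the other two by [K], so that an L^2 distance controls a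
    fourth power. *)
Lemma truncated_pow4 x y K t : 0 < t -> 0 <= K ->
  Num.min `|x| K ^+ 4 <=
  ((1 + t) ^+ 4) * y ^+ 4 + K ^+ 2 * (1 + t^-1) ^+ 2 * (x - y) ^+ 2.
Proof.
move=> t0 K0; set h := Num.min _ _.
have h0 : 0 <= h by rewrite le_min normr_ge0.
have hx : h <= `|x| by rewrite ge_min lexx.
have hK : h <= K by rewrite ge_min lexx orbT.
have y4 : 0 <= y ^+ 4 by rewrite exprn_even_ge0.
have [xy|xy] := leP `|x| ((1 + t) * `|y|).
  apply: (@le_trans _ _ ((1 + t) ^+ 4 * y ^+ 4)); last first.
    by rewrite lerDl mulr_ge0 ?sqr_ge0// mulr_ge0 ?sqr_ge0.
  have -> : y ^+ 4 = `|y| ^+ 4 by rewrite -normrX ger0_norm.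
  rewrite -exprMn lerXn2r ?nnegrE//; last exact: le_trans xy.
  by rewrite mulr_ge0// addr_ge0// ltW.
apply: (@le_trans _ _ (K ^+ 2 * (1 + t^-1) ^+ 2 * (x - y) ^+ 2)); last first.
  by rewrite lerDr mulr_ge0// exprn_ge0// addr_ge0// ltW.
rewrite (_ : 4 = 2 + 2)%N// exprD -mulrA ler_pM ?exprn_ge0//.
  by rewrite lerXn2r.
rewrite -exprMn -[X in _ <= X]real_normK ?num_real// lerXn2r ?nnegrE//.
apply: (le_trans hx); rewrite normrM ger0_norm; last first.
  by rewrite addr_ge0// invr_ge0 ltW.
have dxy := lerB_dist x y.
rewrite -(ler_pM2l t0) mulrA.
rewrite (_ : t * (1 + t^-1) = t + 1); last by field; rewrite gt_eqF.
apply: (@le_trans _ _ ((t + 1) * (`|x| - `|y|))); first by lra.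
by rewrite ler_wpM2l// addr_ge0// ltW.
Qed.

(** Convexity gives z^4 >= y^4 + 4 y^3 (z - y), and Young's inequality replaces z by x in the cubic
    term. Adding 3 y^4 + x^4 to both sides makes the left one nonnegative, so that integrals of
    nonnegative functions suffice. *)
Lemma pow4_tangent x y z t : 0 < t ->
  4 * y ^+ 3 * x + 3 * y ^+ 4 + x ^+ 4 <=
  z ^+ 4 + 2 / t * (z - x) ^+ 2 + (2 * t * y ^+ 6 + 6 * y ^+ 4 + x ^+ 4).
Proof.
move=> t0.
have h1 : y ^+ 4 + 4 * y ^+ 3 * (z - y) <= z ^+ 4.
  rewrite -subr_ge0 (_ : _ - _ = (z - y) ^+ 2 * ((z + y) ^+ 2 + 2 * y ^+ 2)); last ring.
  by rewrite mulr_ge0 ?sqr_ge0// addr_ge0 ?sqr_ge0// mulr_ge0 ?sqr_ge0.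
have h2 : - (4 * y ^+ 3 * (z - x)) <= 2 * t * y ^+ 6 + 2 / t * (z - x) ^+ 2.
  rewrite -subr_ge0 (_ : _ - _ = 2 * t * (y ^+ 3 + (z - x) / t) ^+ 2); last first.
    by field; rewrite gt_eqF.
  by rewrite mulr_ge0 ?sqr_ge0// mulr_ge0// ltW.
move: h1 h2; set a := 2 / t * _; set b := 2 * t * _.
rewrite !mulrBr => h1 h2.
have : 4 * y ^+ 3 * y = 4 * y ^+ 4 by ring.
lra.
Qed.

Lemma pow4_tangent_ge0 x y : 0 <= 4 * y ^+ 3 * x + 3 * y ^+ 4 + x ^+ 4.
Proof.
rewrite (_ : _ + _ = (x + y) ^+ 2 * ((x - y) ^+ 2 + 2 * y ^+ 2)); last ring.
by rewrite mulr_ge0 ?sqr_ge0// addr_ge0 ?sqr_ge0// mulr_ge0 ?sqr_ge0.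
Qed.

End RealInequalities.

(** * Second and fourth moments under convergence in square mean *)

Section SquareMeanLimits.
Context {R : realType} {d : measure_display} {T : measurableType d}.
Variable mu : {measure set T -> \bar R}.
Implicit Types f g h : T -> R.

Lemma ge0_integral_lincomb f g (a b : R) :
  measurable_fun setT f -> measurable_fun setT g ->
  (forall x, 0 <= f x) -> (forall x, 0 <= g x) -> 0 <= a -> 0 <= b ->
  (\int[mu]_x (a * f x + b * g x)%:E =
   a%:E * (\int[mu]_x (f x)%:E) + b%:E * (\int[mu]_x (g x)%:E))%E.
Proof.
move=> mf mg f0 g0 a0 b0.
under eq_integral do rewrite EFinD !EFinM.
have mZ (c : R) (u : T -> R) : measurable_fun setT u ->
    measurable_fun setT (fun x => (c%:E * (u x)%:E)%E).
  by move=> mu'; apply/measurable_EFinP; exact: measurable_funM.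
rewrite ge0_integralD//; try exact: mZ; try by move=> x _; rewrite mule_ge0 ?lee_fin.
by rewrite !ge0_integralZl//; try exact/measurable_EFinP; move=> x _; rewrite lee_fin.
Qed.

Lemma ge0_le_integral_lincomb f g h (a b : R) :
  measurable_fun setT f -> measurable_fun setT g -> measurable_fun setT h ->
  (forall x, 0 <= f x) -> (forall x, 0 <= g x) -> (forall x, 0 <= h x) ->
  0 <= a -> 0 <= b -> (forall x, f x <= a * g x + b * h x) ->
  (\int[mu]_x (f x)%:E <=
   a%:E * (\int[mu]_x (g x)%:E) + b%:E * (\int[mu]_x (h x)%:E))%E.
Proof.
move=> mf mg mh f0 g0 h0 a0 b0 fgh.
rewrite -ge0_integral_lincomb//; apply: ge0_le_integral => //.
- by move=> x _; rewrite lee_fin.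
- exact/measurable_EFinP.
- by apply/measurable_EFinP; apply: measurable_funD; apply: measurable_funM.
- by move=> x _; rewrite lee_fin.
Qed.

Lemma lee_lincomb_cvg (I : \bar R) (a b L : R) (m : nat -> R) (e : nat -> \bar R) :
  (\forall n \near \oo, (I <= a%:E * (m n)%:E + b%:E * e n)%E) ->
  m n @[n --> \oo] --> L -> e n @[n --> \oo] --> 0%E -> (I <= (a * L)%:E)%E.
Proof.
move=> Ile mL e0.
apply: (@cvge_ge _ \oo _ _ (fun n => a%:E * (m n)%:E + b%:E * e n)%E) => //.
have -> : ((a * L)%:E = a%:E * L%:E + b%:E * 0)%E by rewrite mule0 adde0.
apply: cvgeD; first by rewrite mule0 fin_num_adde_defl.
  by apply: cvgeZl => //; apply: cvg_EFin => //; exact: nearW.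
exact: cvgeZl.
Qed.

Variables (F : T -> R) (G : nat -> T -> R).
Hypothesis mF : measurable_fun setT F.
Hypothesis mG : forall n, measurable_fun setT (G n).
Hypothesis GF : (\int[mu]_x ((F x - G n x) ^+ 2)%:E)%E @[n --> \oo] --> 0%E.

Let mFG n k : measurable_fun setT (fun x => (F x - G n x) ^+ k).
Proof. by apply: measurable_funX; exact: measurable_funB. Qed.

(** [sqrD_weighted] is used in both directions, for F = G + (F - G) and for G = F + (G - F); then n
    tends to infinity, and t to 0. *)
Lemma integral_sqr_limit (m : nat -> R) (I L : R) :
  (forall n, \int[mu]_x ((G n x) ^+ 2)%:E = (m n)%:E)%E ->
  (\int[mu]_x ((F x) ^+ 2)%:E = I%:E)%E ->
  m n @[n --> \oo] --> L -> I = L.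
Proof.
move=> Gm FI mL.
have cont (c : R) : {for 0, continuous (fun t : R => (1 + t) * c)}.
  by apply: cvgM; [apply: cvgD; [exact: cvg_cst|exact: cvg_id]|exact: cvg_cst].
apply/eqP; rewrite eq_le; apply/andP; split.
  rewrite -lee_fin; apply: (lee_at_right0 _ (cont L)); first by rewrite addr0 mul1r.
  move=> t t0; have t1 : 0 <= 1 + t^-1 by rewrite addr_ge0// invr_ge0 ltW.
  apply: (@lee_lincomb_cvg _ _ (1 + t^-1) _ m _ _ mL GF); apply: nearW => n.
  rewrite -FI -Gm; apply: ge0_le_integral_lincomb => //.
  - exact: measurable_funX.
  - exact: measurable_funX.
  - by move=> x; rewrite sqr_ge0.
  - by move=> x; rewrite sqr_ge0.
  - by move=> x; rewrite sqr_ge0.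
  - by rewrite addr_ge0// ltW.
  - move=> x; have := sqrD_weighted (G n x) (F x - G n x) t0.
    by rewrite addrC subrK.
rewrite -lee_fin; apply: (lee_at_right0 _ (cont I)); first by rewrite addr0 mul1r.
move=> t t0; have t1 : 0 <= 1 + t^-1 by rewrite addr_ge0// invr_ge0 ltW.
have mL' : (m n)%:E @[n --> \oo] --> L%:E by apply: cvg_EFin => //; exact: nearW.
have e0 : (((1 + t) * I)%:E + (1 + t^-1)%:E * \int[mu]_x ((F x - G n x) ^+ 2)%:E)%E
    @[n --> \oo] --> ((1 + t) * I)%:E.
  rewrite -[X in _ --> X]adde0 -(mule0 (1 + t^-1)%:E).
  apply: cvgeD; first by rewrite mule0 fin_num_adde_defl.
    exact: cvg_cst.
  exact: cvgeZl.
apply: (lee_cvg_to mL' e0); apply: nearW => n.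
rewrite EFinM -FI -Gm; apply: ge0_le_integral_lincomb => //.
- exact: measurable_funX.
- exact: measurable_funX.
- by move=> x; rewrite sqr_ge0.
- by move=> x; rewrite sqr_ge0.
- by move=> x; rewrite sqr_ge0.
- by rewrite addr_ge0// ltW.
- move=> x; have := sqrD_weighted (F x) (G n x - F x) t0.
  by rewrite addrC subrK -(sqrrN (G n x - _)) opprB.
Qed.

(** With |F| truncated at K, first n tends to infinity, then t to 0, and last K to infinity by
    monotone convergence. *)
Lemma le_integral_pow4 (m : nat -> R) (L : R) :
  (forall n, \int[mu]_x ((G n x) ^+ 4)%:E = (m n)%:E)%E ->
  m n @[n --> \oo] --> L -> (\int[mu]_x ((F x) ^+ 4)%:E <= L%:E)%E.
Proof.
move=> Gm mL.
pose h (K : nat) x := Num.min `|F x| K%:R.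
have h0 K x : 0 <= h K x by rewrite le_min normr_ge0/=.
have mh K : measurable_fun setT (fun x => h K x ^+ 4).
  apply: measurable_funX; apply: measurable_minr => //.
  exact: measurableT_comp.
have hL K : (\int[mu]_x (h K x ^+ 4)%:E <= L%:E)%E.
  apply: (@lee_at_right0 _ (fun t => (1 + t) ^+ 4 * L)).
  - by rewrite addr0 expr1n mul1r.
  - apply: cvgM; last exact: cvg_cst.
    apply: (@continuous_comp _ _ _ (fun t : R => 1 + t) (fun t => t ^+ 4)).
      by apply: cvgD; [exact: cvg_cst|exact: cvg_id].
    exact: exprn_continuous.
  move=> t t0.
  apply: (@lee_lincomb_cvg _ _ (K%:R ^+ 2 * (1 + t^-1) ^+ 2) _ m _ _ mL GF); apply: nearW => n.
  rewrite -Gm; apply: ge0_le_integral_lincomb => //.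
  - exact: measurable_funX.
  - by move=> x; rewrite exprn_ge0.
  - by move=> x; rewrite exprn_even_ge0.
  - by move=> x; rewrite sqr_ge0.
  - by rewrite exprn_even_ge0.
  - by rewrite mulr_ge0 ?sqr_ge0.
  - by move=> x; exact: truncated_pow4.
have limh x : limn (fun K => (h K x ^+ 4)%:E) = ((F x) ^+ 4)%:E.
  apply: lim_near_cst => //; near=> K; congr (_%:E).
  rewrite /h min_l; first by rewrite -normrX ger0_norm// exprn_even_ge0.
  near: K; exact: nbhs_infty_ger.
under eq_integral do rewrite -limh.
rewrite monotone_convergence//.
- apply: lime_le; last by apply: nearW => K; exact: hL.
  apply: ereal_nondecreasing_is_cvgn => i j ij.
  apply: ge0_le_integral => //.
  + by move=> x _; rewrite lee_fin exprn_ge0.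
  + exact/measurable_EFinP.
  + exact/measurable_EFinP.
  + move=> x _; rewrite lee_fin lerXn2r// ?nnegrE//.
    by rewrite le_min !ge_min lexx/= ler_nat ij orbT.
- by move=> K; exact/measurable_EFinP.
- by move=> K x _; rewrite lee_fin exprn_ge0.
- move=> x _ i j ij; rewrite lee_fin lerXn2r// ?nnegrE//.
  by rewrite le_min !ge_min lexx/= ler_nat ij orbT.
Unshelve. all: by end_near. Qed.

End SquareMeanLimits.

(** * Sums over squares of indices *)

Section SquareSums.
Context {R : realType}.
Implicit Types g : nat * nat -> R.

Definition sqsum g n : R := \sum_(i < n) \sum_(j < n) g (i : nat, j : nat).

Let square n := [seq (i, j) | i <- index_iota 0 n, j <- index_iota 0 n].

Let mem_square n ij : (ij \in square n) = (ij.1 < n)%N && (ij.2 < n)%N.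
Proof.
apply/allpairsP/andP => [[[i j]/= []]|[i1 j2]].
  by rewrite !mem_index_iota/= => ? ? ->.
by exists ij; rewrite !mem_index_iota/=; split => //; case: (ij).
Qed.

Let sqsumE g n : (sqsum g n)%:E = (\sum_(ij \in [set` square n]) (g ij)%:E)%E.
Proof.
rewrite -fsbig_seq; last first.
  by rewrite allpairs_uniq ?iota_uniq// => -[a b] [a' b'].
rewrite sumEFin big_allpairs /sqsum; congr (_%:E).
by rewrite big_mkord; apply: eq_bigr => i _; rewrite big_mkord.
Qed.

Variable g : nat * nat -> R.
Hypothesis g0 : forall ij, 0 <= g ij.

Lemma nondecreasing_sqsum : nondecreasing_seq (sqsum g).
Proof.
move=> m n mn; rewrite -lee_fin !sqsumE; apply: lee_fsum_nneg_subset;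
  [exact: finite_seq|exact: finite_seq| |].
- by move=> ij; rewrite !inE/= !mem_square => /andP[/leq_trans->// /leq_trans->].
- by move=> ij _; rewrite lee_fin.
Qed.

Lemma sqsum_le_lim (l : R) : sqsum g n @[n --> \oo] --> l -> forall n, sqsum g n <= l.
Proof.
move=> gl n; rewrite -(cvg_lim _ gl)//.
apply: nondecreasing_cvgn_le; first exact: nondecreasing_sqsum.
by apply/cvg_ex; exists l.
Qed.

Lemma sqsum_le_esum n : ((sqsum g n)%:E <= \esum_(ij in [set: nat * nat]) (g ij)%:E)%E.
Proof.
apply: esum_ge; exists [set` square n]; rewrite ?sqsumE//.
by split=> //; exact: finite_seq.
Qed.

(** Every finite set of pairs lies in a square, so the supremum over finite sets is reached along
    squares. *)
Lemma esum_sqsum (l : R) : sqsum g n @[n --> \oo] --> l ->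
  (\esum_(ij in [set: nat * nat]) (g ij)%:E = l%:E)%E.
Proof.
move=> gl; apply/eqP; rewrite eq_le; apply/andP; split; last first.
  apply: (@cvge_le _ \oo _ _ (fun n => (sqsum g n)%:E)).
    by apply: nearW => n; exact: sqsum_le_esum.
  by apply: cvg_EFin => //; exact: nearW.
apply: ge_ereal_sup => _ [A [finA _] <-].
have /finite_seqP[t At] := finA.
pose N := (\max_(ij <- t) maxn ij.1 ij.2).+1.
apply: (@le_trans _ _ (sqsum g N)%:E).
  rewrite sqsumE; apply: lee_fsum_nneg_subset => //;
    [exact: finite_seq| |by move=> ij _; rewrite lee_fin].
  move=> ij; rewrite !inE/= mem_square => Aij.
  have : (maxn ij.1 ij.2 < N)%N.
    rewrite ltnS (@leq_bigmax_seq _ _ _ (fun ij => maxn ij.1 ij.2))//.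
    by move: Aij; rewrite At.
  by rewrite gtn_max.
by rewrite lee_fin; exact: sqsum_le_lim.
Qed.

Lemma cvg_sqsum_bounded (M : R) : (forall n, sqsum g n <= M) -> cvgn (sqsum g).
Proof.
move=> gM; apply: nondecreasing_is_cvgn; first exact: nondecreasing_sqsum.
by exists M => _ [n _ <-]; exact: gM.
Qed.

Lemma cvg_sqsum (l : R) :
  (\esum_(ij in [set: nat * nat]) (g ij)%:E = l%:E)%E -> sqsum g n @[n --> \oo] --> l.
Proof.
move=> gl; have /cvg_ex[l' gl'] : cvgn (sqsum g).
  apply: (@cvg_sqsum_bounded l) => n.
  by rewrite -lee_fin -gl; exact: sqsum_le_esum.
by move: gl; rewrite (esum_sqsum gl') => -[<-].
Qed.

End SquareSums.

Lemma sqsum_diag (R : realType) (g : nat * nat -> R) n :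
  sqsum (fun ij => (g ij * \1_(~` Delta2) ij) ^+ 2) n = \sum_(i < n) g (i : nat, i : nat) ^+ 2.
Proof.
apply: eq_bigr => i _; rewrite (bigD1 i)//= big1 => [|j ji].
  by rewrite indicE mem_set ?mulr1 ?addr0// => /(_ erefl).
rewrite indicE memNset ?mulr0 ?expr0n//= => /contrapT/= ij.
by move/eqP: ji; apply; exact/val_inj.
Qed.

Lemma sqsum_offdiag (R : realType) (g : nat * nat -> R) n :
  sqsum (fun ij => (g ij * \1_Delta2 ij) ^+ 2) n =
  sqsum (fun ij => g ij ^+ 2) n - \sum_(i < n) g (i : nat, i : nat) ^+ 2.
Proof.
rewrite -sqsum_diag -sumrB; apply: eq_bigr => i _; rewrite -sumrB.
apply: eq_bigr => j _; rewrite !indicE in_setC.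
by case: (_ \in _) => /=; ring.
Qed.

(** * Convergence of the truncated contraction norms *)

Section DominatedSquares.
Context {R : realType}.
Variables (f : nat * nat -> R) (s : R).
Hypothesis fs : sqsum (fun ij => f ij ^+ 2) n @[n --> \oo] --> s.

Let sqsum_le n : sqsum (fun ij => f ij ^+ 2) n <= s.
Proof. by apply: sqsum_le_lim fs _ => ij; rewrite sqr_ge0. Qed.

Let s0 : 0 <= s.
Proof.
apply: le_trans (sqsum_le 0).
by rewrite sumr_ge0// => i _; rewrite sumr_ge0// => j _; rewrite sqr_ge0.
Qed.

Let r n i := \sum_(a < n) f (i, a : nat) ^+ 2.

Let r_ge0 n i : 0 <= r n i.
Proof. by rewrite sumr_ge0// => a _; rewrite sqr_ge0. Qed.

Let r_le m n i : (m <= n)%N -> r m i <= r n i.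
Proof.
move=> mn; rewrite /r -!(big_mkord xpredT (fun a => f (i, a) ^+ 2)).
rewrite (big_cat_nat _ mn)//= lerDl sumr_ge0// => a _; exact: sqr_ge0.
Qed.

Let r_les n i : r n i <= s.
Proof.
(* A square of this side contains the first [n] entries of row [i], even when [i >= n]. *)
apply: le_trans (sqsum_le (maxn n i.+1)).
apply: (le_trans (r_le i (leq_maxl n i.+1))).
have im : (i < maxn n i.+1)%N by rewrite leq_max ltnSn orbT.
rewrite /sqsum (bigD1 (Ordinal im))//= lerDl sumr_ge0// => k _.
by rewrite sumr_ge0// => j _; rewrite sqr_ge0.
Qed.

Lemma sqr_le_sqsum_lim ij : f ij ^+ 2 <= s.
Proof.
case: ij => i j; apply: le_trans (r_les j.+1 i).
by rewrite /r big_ord_recr/= lerDr sumr_ge0// => a _; rewrite sqr_ge0.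
Qed.

Definition star_partial n (ij : nat * nat) :=
  \sum_(a < n) f (ij.1, a : nat) * f (ij.2, a : nat).

(** By Lagrange's identity, twice the defect is a sum of squares. *)
Lemma CauchySchwarz_sum n (u v : 'I_n -> R) :
  (\sum_a u a * v a) ^+ 2 <= (\sum_a u a ^+ 2) * (\sum_a v a ^+ 2).
Proof.
have E : \sum_a \sum_b (u a * v b - u b * v a) ^+ 2 =
    2 * ((\sum_a u a ^+ 2) * (\sum_a v a ^+ 2) - (\sum_a u a * v a) ^+ 2).
  have sqE a b : (u a * v b - u b * v a) ^+ 2 =
    u a ^+ 2 * v b ^+ 2 + v a ^+ 2 * u b ^+ 2 - 2 * (u a * v a) * (u b * v b).
    by ring.
  under eq_bigr do under eq_bigr do rewrite sqE.
  under eq_bigr do rewrite sumrB big_split/= -!mulr_sumr.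
  by rewrite sumrB big_split/= -!mulr_suml -mulr_sumr; ring.
rewrite -subr_ge0 -(pmulr_rge0 _ (ltr0Sn R 1)) -E.
by rewrite sumr_ge0// => a _; rewrite sumr_ge0// => b _; rewrite sqr_ge0.
Qed.

Lemma sqr_star_partial_le n ij : star_partial n ij ^+ 2 <= r n ij.1 * r n ij.2.
Proof. exact: CauchySchwarz_sum. Qed.

(** The series converges absolutely, since |uv| <= u^2 + v^2 and the rows of [f] are
    square-summable. *)
Lemma cvg_star_partial ij : star_partial n ij @[n --> \oo] --> star11 f ij.
Proof.
rewrite (_ : (fun n => _) = series (fun a => f (ij.1, a) * f (ij.2, a))); last first.
  by apply/funext => n; rewrite /series/= big_mkord.
suff : cvgn (series (fun a => f (ij.1, a) * f (ij.2, a))) by [].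
apply: normed_cvg.
apply: (@series_le_cvg _ _ (fun a => f (ij.1, a) ^+ 2 + f (ij.2, a) ^+ 2)).
- by move=> a /=.
- by move=> a; rewrite addr_ge0// sqr_ge0.
- move=> a /=; rewrite normrM.
  rewrite -(real_normK (num_real (f (ij.1, a)))) -(real_normK (num_real (f (ij.2, a)))).
  have := sqr_ge0 (`|f (ij.1, a)| - `|f (ij.2, a)|).
  have := mulr_ge0 (normr_ge0 (f (ij.1, a))) (normr_ge0 (f (ij.2, a))).
  rewrite sqrrB; lra.
apply: nondecreasing_is_cvgn.
  apply/nondecreasing_seqP => n; rewrite /series/= big_nat_recr//= lerDl.
  by rewrite addr_ge0// sqr_ge0.
exists (s + s) => _ [n _ <-].
by rewrite /series/= big_split/= !big_mkord lerD// r_les.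
Qed.

(** Stands for the indicator of [Delta2] or of its complement, so that one argument serves both
    norms. *)
Variable w : nat * nat -> R.
Hypothesis w1 : forall ij, w ij ^+ 2 <= 1.

(** [M] bounds the outer indices and [n] the inner sum. The finite moments involve [T n n], while
    the norm in the theorem is the limit in [n] followed by that in [M]. *)
Let T M n := sqsum (fun ij => (star_partial n ij * w ij) ^+ 2) M.
Let Tlim M := sqsum (fun ij => (star11 f ij * w ij) ^+ 2) M.
Let Rsum M n := \sum_(i < M) r n i.

Let cvg_T M : T M n @[n --> \oo] --> Tlim M.
Proof.
apply: cvg_big => [|i _]; first exact: add_continuous.
apply: cvg_big => [|j _]; first exact: add_continuous.
have h : star_partial n (i : nat, j : nat) * w (i : nat, j : nat) @[n --> \oo] -->
    star11 f (i : nat, j : nat) * w (i : nat, j : nat).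
  by apply: cvgM; [exact: cvg_star_partial|exact: cvg_cst].
by under eq_fun do rewrite expr2; rewrite expr2; exact: cvgM.
Qed.

(** The left-hand side is a sum over the square of side [M] of the nonnegative
    terms [r n i * r n k - (star_partial n (i, k) * w (i, k)) ^+ 2]. *)
Let T_gap M n : (M <= n)%N -> Rsum M n ^+ 2 - T M n <= Rsum n n ^+ 2 - T n n.
Proof.
pose D ij := r n ij.1 * r n ij.2 - (star_partial n ij * w ij) ^+ 2.
have TE m : Rsum m n ^+ 2 - T m n = sqsum D m.
  rewrite /sqsum /D; under eq_bigr do rewrite sumrB /= -mulr_sumr.
  by rewrite sumrB -mulr_suml expr2.
rewrite !TE; apply: nondecreasing_sqsum => ij; rewrite subr_ge0.
rewrite exprMn; apply: le_trans (sqr_star_partial_le n ij).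
by rewrite ler_piMr ?sqr_ge0.
Qed.

Let Rsum_le n : Rsum n n <= s. Proof. exact: sqsum_le. Qed.

Let Rsum_ge M n : (M <= n)%N -> sqsum (fun ij => f ij ^+ 2) M <= Rsum M n.
Proof. by move=> Mn; apply: ler_sum => i _; exact: r_le. Qed.

Let sqsum_ge0 (g : nat * nat -> R) M : (forall ij, 0 <= g ij) -> 0 <= sqsum g M.
Proof. by move=> g0; rewrite sumr_ge0// => i _; rewrite sumr_ge0. Qed.

Let Rsum_ge0 M n : 0 <= Rsum M n.
Proof. by rewrite sumr_ge0. Qed.

(** Enlarging the square raises [T] by no more than its dominating sum. The resulting error depends
    on [M] alone and vanishes as [M] grows. *)
Let T_upper M n : (M <= n)%N ->
  T n n <= T M n + (s ^+ 2 - sqsum (fun ij => f ij ^+ 2) M ^+ 2).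
Proof.
move=> Mn; have := T_gap Mn.
have h1 : Rsum n n ^+ 2 <= s ^+ 2 by rewrite lerXn2r ?nnegrE.
have h2 : sqsum (fun ij => f ij ^+ 2) M ^+ 2 <= Rsum M n ^+ 2.
  by rewrite lerXn2r ?nnegrE ?Rsum_ge// sqsum_ge0// => ij; rewrite sqr_ge0.
lra.
Qed.

Let T_lower M n : (M <= n)%N -> T M n <= T n n.
Proof. by move=> Mn; apply: nondecreasing_sqsum => // ij; rewrite sqr_ge0. Qed.

(** An interchange of limits. First [M] makes [l - Tlim M] and the uniform error of [T_upper]
    smaller than e/2, then [n] brings [T M n] within e/2 of [Tlim M]; [T n n] is squeezed between
    [T_lower] and [T_upper]. *)
Lemma cvg_sqsum_star : exists l : R,
  (sqsum (fun ij => (star11 f ij * w ij) ^+ 2) n @[n --> \oo] --> l) /\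
  (sqsum (fun ij => (star_partial n ij * w ij) ^+ 2) n @[n --> \oo] --> l).
Proof.
have Tlim_le M : Tlim M <= s ^+ 2.
  rewrite -(cvg_lim _ (@cvg_T M))//; apply: limr_le.
    by apply/cvg_ex; exists (Tlim M); exact: cvg_T.
  near=> n; have Mn : (M <= n)%N by near: n; exact: nbhs_infty_ge.
  apply: le_trans (T_lower Mn) _.
  (* For the empty square the upper bound reads [T n n <= s ^+ 2]. *)
  have := @T_upper 0 n isT.
  by rewrite /T /sqsum !big_ord0 expr0n/= add0r subr0.
have Tlim_nd : nondecreasing_seq Tlim.
  by apply: nondecreasing_sqsum => ij; rewrite sqr_ge0.
have /cvg_ex[l Tl] : cvgn Tlim.
  by apply: nondecreasing_is_cvgn => //; exists (s ^+ 2) => _ [M _ <-].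
exists l; split => //.
have Tlim_lel M : Tlim M <= l.
  rewrite -(cvg_lim _ Tl)//; apply: nondecreasing_cvgn_le => //.
  by apply/cvg_ex; exists l.
have S2 : sqsum (fun ij => f ij ^+ 2) n ^+ 2 @[n --> \oo] --> s ^+ 2.
  by under eq_fun do rewrite expr2; rewrite expr2; exact: cvgM.
apply/cvgrPdist_lt => e e0.
have e2 : 0 < e / 2 by rewrite divr_gt0.
have [M [hM1 hM2]] : exists M, `|l - Tlim M| < e / 2 /\
    `|s ^+ 2 - sqsum (fun ij => f ij ^+ 2) M ^+ 2| < e / 2.
  near \oo => M; exists M; split; near: M.
    by move/cvgrPdist_lt : Tl; exact.
  by move/cvgrPdist_lt : S2; exact.
near=> n.
have Mn : (M <= n)%N by near: n; exact: nbhs_infty_ge.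
have hn : `|Tlim M - T M n| < e / 2.
  by near: n; move/cvgrPdist_lt : (@cvg_T M); exact.
have := T_upper Mn; have := T_lower Mn; have := Tlim_lel M.
move: hM1 hM2 hn; rewrite -/(T n n) !ltr_norml.
move=> /andP[? ?] /andP[? ?] /andP[? ?] ? ? ?; lra.
Unshelve. all: by end_near. Qed.

End DominatedSquares.

(** * The quadratic chaos *)

Section QuadraticChaos.
Context {R : realType} {d : measure_display} {T : measurableType d}.
Context {P : probability T R} {X : nat -> {RV P >-> R}}.
Hypothesis hX : rademacher_sequence X.
Variables (f : nat * nat -> R) (F : {RV P >-> R}).
Hypothesis hF : is_J2 X f F.

Let A := curry f.
Let G n w := quadform n A (signs X n w).

Let mG n : measurable_fun setT (G n).
Proof. exact: (@measurable_signs _ _ _ _ X (quadform n A) n). Qed.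

(** Puts [G m] and [G k] over the same [k] signs, so that [signmean k] computes their joint
    moments. *)
Let GE m k w : (m <= k)%N -> G m w = quadform m A (signs X k w).
Proof.
have sE i j : (i < j)%N -> signs X j w i = (X i w == 1) by rewrite /signs => ->.
move=> mk; apply: eq_bigr => j _.
have jk : (j < k)%N := leq_trans (ltn_ord j) mk.
rewrite !sE//; congr (2 * _ * _); apply: eq_bigr => i _.
by rewrite !sE// (ltn_trans (ltn_ord i)).
Qed.

(** The integral is the square of the norm in [is_J2], once partial sums are replaced by functions
    of bits off a null set. *)
Lemma cvg_quadform_sqr_dist :
  (\int[P]_w ((F w - quadform n A (signs X n w)) ^+ 2)%:E)%E @[n --> \oo] --> 0%E.
Proof.
have E n : (\int[P]_w ((F w - G n w) ^+ 2)%:E =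
    Lnorm P 2%:E (fun w => (J2_partial X f n w - F w)%:E)
    * Lnorm P 2%:E (fun w => (J2_partial X f n w - F w)%:E))%E.
  have poweR2 (x : \bar R) : (0 <= x -> x * x = x `^ 2)%E.
    move=> x0; rewrite (_ : 2%R = 1 + 1 :> R)// poweRD ?poweRe1//.
    by apply: add_neq0_poweRD_def; rewrite -mulr2n pnatr_eq0.
  rewrite poweR2 ?Lnorm_ge0// poweR_Lnorm//.
  under [RHS]eq_integral do rewrite /= powR_mulrn// real_normK ?num_real//.
  have mJ : measurable_fun setT (J2_partial X f n).
    apply: measurable_funM => //; apply: measurable_sum => j.
    by apply: measurable_sum => i; do 2! apply: measurable_funM => //.
  apply: ge0_ae_eq_integral => //.
  + by apply/measurable_EFinP; apply: measurable_funX; exact: measurable_funB.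
  + by apply/measurable_EFinP; apply: measurable_funX; exact: measurable_funB.
  + by move=> w _; rewrite lee_fin sqr_ge0.
  + by move=> w _; rewrite lee_fin sqr_ge0.
  apply: filterS (ae_J2_partial hX f n) => w -> _.
  by rewrite -sqrrN opprB.
under eq_fun do rewrite E; rewrite -(mule0 0%E).
exact: cvgeM.
Qed.

(** [pow4_tangent] is integrated with y = [G m], x = [G k] and z = [F]. After cancelling common
    finite terms, [mean4] is at most E[F^4] + (2/t) E[(F - G_k)^2] + 2 t [mean6]; then k tends to
    infinity, and t to 0. *)
Lemma signmean_quadform4_le m :
  ((signmean m (fun b => quadform m A b ^+ 4))%:E <= \int[P]_w ((F w) ^+ 4)%:E)%E.
Proof.
set I := (X in (_ <= X)%E).
have I0 : (0 <= I)%E.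
  by apply: integral_ge0 => w _; rewrite lee_fin exprn_even_ge0.
set q := fun b => quadform m A b.
set mean4 := signmean m (fun b => q b ^+ 4).
set mean6 := signmean m (fun b => q b ^+ 6).
case IE : I I0 => [c| |]// _; last by rewrite leey.
apply: (lee_at_right0 (u := fun t => c + t * (2 * mean6))).
- by rewrite mul0r addr0.
- by apply: cvgD; [exact: cvg_cst|apply: cvgM; [exact: cvg_id|exact: cvg_cst]].
move=> t t0; rewrite -[c + _]mul1r.
apply: (lee_lincomb_cvg (b := 2 / t) _ (cvg_cst _) cvg_quadform_sqr_dist).
near=> k; have mk : (m <= k)%N by near: k; exact: nbhs_infty_ge.
pose p b := quadform k A b.
set e := integral _ _ _.
have mean4k : signmean k (fun b => q b ^+ 4) = mean4 by exact: signmean_quadform_stable.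
have mean6k : signmean k (fun b => q b ^+ 6) = mean6 by exact: signmean_quadform_stable.
set mean4p := signmean k (fun b => p b ^+ 4).
(* The cubic term yields four copies of [mean4] and the next term three; six of the seven are set
   apart to cancel against [rhs]. *)
have lhs : (\int[P]_w (4 * G m w ^+ 3 * G k w + 3 * G m w ^+ 4 + G k w ^+ 4)%:E =
    (mean4 + (6 * mean4 + mean4p))%:E)%E.
  under eq_integral do rewrite (GE _ mk).
  rewrite (integral_signs hX
    (g := fun b => 4 * q b ^+ 3 * p b + 3 * q b ^+ 4 + p b ^+ 4)); last first.
    by move=> b; exact: pow4_tangent_ge0.
  rewrite !signmeanD; under eq_signmean do rewrite -mulrA.
  rewrite !signmeanZ (signmean_quadform_cube _ mk) mean4k.
  by congr (_%:E); rewrite /mean4p; ring.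
have rhs : (\int[P]_w (2 * t * G m w ^+ 6 + 6 * G m w ^+ 4 + G k w ^+ 4)%:E =
    (2 * t * mean6 + (6 * mean4 + mean4p))%:E)%E.
  under eq_integral do rewrite (GE _ mk).
  rewrite (integral_signs hX
    (g := fun b => 2 * t * q b ^+ 6 + 6 * q b ^+ 4 + p b ^+ 4)); last first.
    move=> b; rewrite addr_ge0 ?exprn_even_ge0// addr_ge0// mulr_ge0 ?exprn_even_ge0//.
    by rewrite mulr_ge0// ltW.
  by rewrite !signmeanD !signmeanZ mean4k mean6k -addrA.
have m4 (g : T -> R) : measurable_fun setT g -> measurable_fun setT (fun w => g w ^+ 4).
  exact: measurable_funX.
have mFk : measurable_fun setT (fun w => (F w - G k w) ^+ 2).
  by apply: measurable_funX; exact: measurable_funB.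
have key : ((mean4 + (6 * mean4 + mean4p))%:E <=
  1%:E * \int[P]_w (1 * F w ^+ 4 + 2 / t * (F w - G k w) ^+ 2)%:E +
  1%:E * (2 * t * mean6 + (6 * mean4 + mean4p))%:E)%E.
  rewrite -lhs -rhs; apply: ge0_le_integral_lincomb => //.
  - apply: measurable_funD; last exact: m4.
    apply: measurable_funD; apply: measurable_funM => //; last exact: m4.
    by apply: measurable_funM => //; exact: measurable_funX.
  - by apply: measurable_funD; apply: measurable_funM => //; exact: m4.
  - apply: measurable_funD; last exact: m4.
    apply: measurable_funD; apply: measurable_funM => //; last exact: m4.
    exact: measurable_funX.
  - by move=> w; exact: pow4_tangent_ge0.
  - move=> w; rewrite mul1r addr_ge0 ?exprn_even_ge0//.
    by rewrite mulr_ge0 ?sqr_ge0// divr_ge0// ltW.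
  - move=> w; rewrite addr_ge0 ?exprn_even_ge0// addr_ge0// mulr_ge0 ?exprn_even_ge0//.
    by rewrite mulr_ge0// ltW.
  - by move=> w; rewrite !mul1r; exact: pow4_tangent.
move: key; rewrite ge0_integral_lincomb//; last first.
- by rewrite divr_ge0// ltW.
- by move=> w; rewrite sqr_ge0.
- by move=> w; rewrite exprn_even_ge0.
- exact: m4.
rewrite -/I IE -/e !mul1e EFinD (EFinD (2 * t * mean6)) addeA leeD2rE//.
by rewrite EFinD addeAC mulrA (mulrC t).
Unshelve. all: by end_near. Qed.

End QuadraticChaos.

(** * The fourth moment formula in the limit *)

Theorem lemma4p3 (R : realType) (d : measure_display) (T : measurableType d)
    (P : probability T R) (X : nat -> {RV P >-> R})
    (hX : rademacher_sequence X)
    (f : nat * nat -> R) (hf : in_l20_sym2 f)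
    (F : {RV P >-> R}) (hF : is_J2 X f F)
    (hF2 : ('E_P[fun w => (F w ^+ 2)%R] = 1)%E) :
  ('E_P[fun w => (F w ^+ 4)%R] =
   3%:E + 32%:E * lpnormX 4 f
   + 48%:E * (lpnormX 2 (fun ij => (star11 f ij * \1_Delta2 ij)%R)
              - lpnormX 2 (fun ij => (star11 f ij * \1_(~` Delta2) ij)%R)))%E.
Proof.
case: hf => fsym fdiag f2fin.
pose A := curry f.
have Asym i j : A i j = A j i by exact: fsym.
have Adiag i : A i i = 0 by apply: (fdiag (i, i)) => /(_ erefl).
have lp2 g : lpnormX 2 g = (\esum_(ij in [set: nat * nat]) (g ij ^+ 2)%:E)%E.
  by apply: eq_esum => ij _; rewrite real_normK ?num_real.
have lp4 g : lpnormX 4 g = (\esum_(ij in [set: nat * nat]) (g ij ^+ 4)%:E)%E.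
  by apply: eq_esum => ij _; rewrite -normrX ger0_norm// exprn_even_ge0.
have f2ge0 ij : 0 <= f ij ^+ 2 by rewrite sqr_ge0.
have f4ge0 ij : 0 <= f ij ^+ 4 by rewrite exprn_even_ge0.
have [s sE] : exists s : R, lpnormX 2 f = s%:E.
  have : (0 <= lpnormX 2 f)%E by apply: esum_ge0 => ij _; rewrite lee_fin exprn_ge0.
  by case: lpnormX f2fin => // s _ _; exists s.
have fs : sqsum (fun ij => f ij ^+ 2) n @[n --> \oo] --> s.
  by apply: cvg_sqsum => //; rewrite -lp2.
have [s4 fs4] : exists s4 : R, sqsum (fun ij => f ij ^+ 4) n @[n --> \oo] --> s4.
  suff /cvg_ex[s4] : cvgn (sqsum (fun ij => f ij ^+ 4)) by exists s4.
  (* Each [f ij ^+ 2] is at most [s], so [f ij ^+ 4 <= s * f ij ^+ 2]. *)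
  apply: (@cvg_sqsum_bounded _ _ _ (s * s)) => // n.
  have h : s * sqsum (fun ij => f ij ^+ 2) n @[n --> \oo] --> s * s.
    by apply: cvgM => //; exact: cvg_cst.
  apply: (@le_trans _ _ (s * sqsum (fun ij => f ij ^+ 2) n)).
    rewrite /sqsum mulr_sumr; apply: ler_sum => i _; rewrite mulr_sumr.
    apply: ler_sum => j _; rewrite (_ : 4 = 2 + 2)%N// exprD ler_wpM2r//.
    exact: sqr_le_sqsum_lim fs _.
  by rewrite ler_wpM2l ?(le_trans (f2ge0 (0, 0)%N))//;
    [exact: sqr_le_sqsum_lim fs _|exact: sqsum_le_lim].
have ind_le1 (D : set (nat * nat)) ij : (\1_D ij : R) ^+ 2 <= 1.
  by rewrite indicE; case: (_ \in _); rewrite /= ?expr1n// expr0n.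
have [lD [starD partD]] := cvg_sqsum_star fs (ind_le1 Delta2).
have [lC [starC partC]] := cvg_sqsum_star fs (ind_le1 (~` Delta2)).
have meanE n : signmean n (fun b => quadform n A b ^+ 4) =
    12 * sqsum (fun ij => f ij ^+ 2) n ^+ 2 + 32 * sqsum (fun ij => f ij ^+ 4) n
    + 48 * (sqsum (fun ij => (star_partial f n ij * \1_Delta2 ij) ^+ 2) n
            - sqsum (fun ij => (star_partial f n ij * \1_(~` Delta2) ij) ^+ 2) n).
  rewrite signmean_quadform4// -/(sqsum (fun ij => f ij ^+ 2) n).
  (* The full sum less twice its diagonal is the off-diagonal part less the diagonal one. *)
  rewrite sqsum_offdiag sqsum_diag; congr (_ + _ * _).
  by rewrite mulr_natl mulr2n opprD addrA.
have dist0 := cvg_quadform_sqr_dist hX hF.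
have mG n : measurable_fun setT (fun w => quadform n A (signs X n w)).
  exact: (@measurable_signs _ _ _ _ X (quadform n A) n).
(* The normalization E[F^2] = 1 enters here; it turns [12 * s ^+ 2] into the constant 3. *)
have s_half : 1 = 2 * s.
  apply: (@integral_sqr_limit _ _ _ P F _ _ mG dist0
    (fun n => 2 * sqsum (fun ij => f ij ^+ 2) n)) => //.
  - move=> n; rewrite (integral_signs hX (g := fun b => quadform n A b ^+ 2)).
      by rewrite signmean_quadform_sqr.
    by move=> b; rewrite sqr_ge0.
  - by rewrite -hF2 unlock.
  - by apply: cvgM => //; exact: cvg_cst.
have sqr_cvg : sqsum (fun ij => f ij ^+ 2) n ^+ 2 @[n --> \oo] --> s ^+ 2.
  by under eq_fun do rewrite expr2; rewrite expr2; exact: cvgM.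
have mean_cvg : signmean n (fun b => quadform n A b ^+ 4) @[n --> \oo] -->
    12 * s ^+ 2 + 32 * s4 + 48 * (lD - lC).
  under eq_fun do rewrite meanE.
  apply: cvgD; [apply: cvgD|]; (apply: cvgM; first exact: cvg_cst) => //.
  exact: cvgB.
transitivity (12 * s ^+ 2 + 32 * s4 + 48 * (lD - lC))%:E; last first.
  rewrite lp4 (esum_sqsum f4ge0 fs4) !lp2.
  rewrite (esum_sqsum _ starD); last by move=> ij; rewrite sqr_ge0.
  rewrite (esum_sqsum _ starC); last by move=> ij; rewrite sqr_ge0.
  rewrite -!(EFinM, EFinB, EFinD); congr (_%:E).
  by rewrite (_ : s = 2^-1); [field|lra].
(* The upper bound comes from truncation; for the lower one, every finite fourth moment is at most
   E[F^4]. *)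
rewrite unlock; apply/eqP; rewrite eq_le; apply/andP; split.
  apply: (@le_integral_pow4 _ _ _ P F _ _ mG dist0 _ _ _ mean_cvg) => // n.
  rewrite (integral_signs hX (g := fun b => quadform n A b ^+ 4))// => b.
  by rewrite exprn_even_ge0.
apply: (@cvge_le _ \oo _ _ (fun n => (signmean n (fun b => quadform n A b ^+ 4))%:E)).
  by apply: nearW => n; exact: (signmean_quadform4_le hX hF).
by apply: cvg_EFin => //; exact: nearW.
Qed.
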